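(* Let $\mathbf{D}=(D_1,\dots,D_k)$ be a straight bosonic multiline queue on $n$ sites. Then the bosonic pairing procedure coincides with the bosonic Ferrari–Martin algorithm on $\mathbf{D}$: both assign the same labels to the particles of $\mathbf{D}$ (the same multiset of labels at every site of every row $j$, the labelling of row $j$ in the pairing procedure being $D_j^{(j)}(\cdots D_k^{(k)}(\widetilde{\mathbf{w}}_0)\cdots)$); in particular $\widetilde\Phi(\mathbf{D})=\widetilde\Phi_{\mathrm{FM}}(\mathbf{D})$.
   Context: Fix $n\ge1$, $[n]=\{1,\dots,n\}$; sites are considered cyclically (in $\mathbb{Z}/n\mathbb{Z}$). $\mathcal{M}(n)$ is the set of finite multisets with entries in $[n]$. A bosonic multiline queue of type $(\alpha,n)$, $\alpha=(\alpha_1,\dots,\alpha_k)$ a sequence of nonnegative integers, is a tuple $\mathbf{D}=(D_1,\dots,D_k)$ with $D_j\in\mathcal{M}(n)$, $|D_j|=\alpha_j$ (row 1 is the bottom row; multiplicity of $j$ in $D_i$ = number of particles at site $j$ of row $i$). It is straight if $\alpha$ is a partition ($\alpha_1\ge\cdots\ge\alpha_k$). $\widetilde{\mathcal{W}}$ is the set of words $(A_1,\dots,A_n)$ of finite multisets of positive integers. Pairing. For $A,B\in\mathcal{M}(n)$ ($A$ the lower row, $B$ the upper row), $\mathrm{cpair_b}(A,B)$ (''cylindrically pairing strictly to the left from $B$ to $A$'') is: for $j=1,\dots,n$ in order, write '')'' once for each instance of $j$ in $B$ and then ''('' once for each instance of $j$ in $A$; view the bracket word on a circle and recursively match each ''(''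 with a '')'' following it cyclically when there are no unmatched brackets between them. A particle is paired (unpaired) if its bracket is matched (unmatched); particles are counted with multiplicity at each site. Bosonic Ferrari–Martin algorithm on a straight $\mathbf{D}=(D_1,\dots,D_k)$: for $r=k,k-1,\dots,1$, label all unlabelled particles in row $r$ with $r$; then (if $r>1$), for $\ell=k,k-1,\dots,r$, cylindrically pair all particles of row $r$ with label $\ell$ strictly to the left to the not-yet-paired particles of row $r-1$, and give the newly paired particles of row $r-1$ the label $\ell$. $\widetilde\Phi_{\mathrm{FM}}(\mathbf{D})\in\widetilde{\mathcal{W}}$ is the word whose $j$-th letter is the multiset of labels of the particles at site $j$ of row 1. Operators $D^{(\ell)}$. For $D\in\mathcal{M}(n)$, $\ell\ge1$ and $\widetilde{\mathbf{u}}=(\widetilde u_1,\dots,\widetilde u_n)\in\widetilde{\mathcal{W}}$ with $\ell<\min\bigcup_i\widetilde u_i$, define $D^{(\ell)}(\widetilde{\mathbf{u}})=(Y_1,\dots,Y_n)\in\widetilde{\mathcal{W}}$ as follows. Initialize all $Y_j=\emptyset$. Let $a=\min\bigcup_i\widetilde u_i$, $K=\max\bigcup_i\widetilde u_i$, and let $\widetilde u^{(r)}\in\mathcal{M}(n)$ be the multiset in which $j$ has multiplicity equal to the number of elements $\ge r$ of $\widetilde u_j$. Pairing phase: let $s$ be the maximal $r\in\{a,\dots,K\}$ with $|\widetilde u^{(r)}|\ge|D|$, if it exists, and $s=a$ otherwise. For $r=K,K-1,\dots,s$: for each newly paired particle of $D$ at site $j$, add an element $r$ to $Y_j$ (the number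 of newly paired particles at site $j$ is the number of particles of $D$ at $j$ paired in $\mathrm{cpair_b}(D,\widetilde u^{(r)})$ minus the number paired in $\mathrm{cpair_b}(D,\widetilde u^{(r+1)})$). Then for each particle of $D$ unpaired in $\mathrm{cpair_b}(D,\widetilde u^{(s)})$, at site $j$ say, add an element $\ell$ to $Y_j$. Collapsing phase: for $r=s,s-1,\dots,a$: for each newly unpaired particle of $\widetilde u^{(r)}$ at site $j$, add an element $r-1$ to $Y_j$ (the number of newly unpaired particles at $j$ is the number of particles of $\widetilde u^{(r)}$ at $j$ unpaired in $\mathrm{cpair_b}(D,\widetilde u^{(r)})$ minus the number of particles of $\widetilde u^{(r+1)}$ at $j$ unpaired in $\mathrm{cpair_b}(D,\widetilde u^{(r+1)})$). For the empty word $\widetilde{\mathbf{w}}_0=(\emptyset,\dots,\emptyset)$, $D^{(\ell)}(\widetilde{\mathbf{w}}_0)$ has at site $j$ the multiset consisting of $\ell$ repeated as many times as $j$ occurs in $D$. Bosonic pairing procedure / projection: $\widetilde\Phi(\mathbf{D})=D_1^{(1)}\bigl(D_2^{(2)}(\cdots D_k^{(k)}(\widetilde{\mathbf{w}}_0)\cdots)\bigr)$. *)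

(* Defs.v *)
From mathcomp Require Import all_boot.
From mathcomp Require Import finmap multiset.

Set Implicit Arguments.
Unset Strict Implicit.
Unset Printing Implicit Defensive.

Local Open Scope mset_scope.

(* Sites are 0-based, i : 'I_n standing for site i.+1; row indices i : 'I_k are
   also 0-based, i standing for row i.+1, but labels are the 1-based row
   numbers. Row 0 is the bottom row. *)

Definition bmlq (k n : nat) : Type := k.-tuple {mset 'I_n}.

Definition bmlq_type (k n : nat) (D : bmlq k n) : seq nat :=
  [seq size (d : {mset 'I_n}) | d <- D].

Definition straight (k n : nat) (D : bmlq k n) : bool := sorted geq (bmlq_type D).

Definition word (n : nat) : predArgType := {ffun 'I_n -> {mset nat}}.

Definition empty_word (n : nat) : word n := [ffun=> mset0].

Definition mset_of_mult (n : nat) (c : 'I_n -> nat) : {mset 'I_n} :=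
  seq_mset (flatten [seq nseq (c j) j | j <- enum 'I_n]).

Lemma mset_of_multE (n : nat) (c : 'I_n -> nat) (j : 'I_n) :
  mset_of_mult c j = c j.
Proof.
rewrite mset_seqE count_flatten -map_comp sumn_map big_enum (bigD1 j) //=.
rewrite count_nseq /= eqxx mul1n big1 ?addn0 // => i /negPf ne_ij.
by rewrite count_nseq /= ne_ij mul0n.
Qed.

(* A bracket is a pair (b, j): b = true is an opening bracket "(" (a particle of
   the lower row), b = false a closing bracket ")" (a particle of the upper
   row), and j is the site of the particle. *)
Definition bracket_word (n : nat) (A B : {mset 'I_n}) : seq (bool * 'I_n) :=
  flatten [seq nseq (B j) (false, j) ++ nseq (A j) (true, j) | j <- enum 'I_n].

Definition cancel_front (n : nat) (w : seq (bool * 'I_n)) :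
    option (seq (bool * 'I_n)) :=
  if w is (true, _) :: (false, _) :: w' then Some w' else None.

(* On a circle, a word matters up to rotation only: one step matches and
   deletes the first "(" immediately followed, cyclically, by a ")". Deleted
   brackets are the matched ones, so "immediately followed" means that no
   unmatched bracket lies in between. *)
Definition cancel_step (n : nat) (w : seq (bool * 'I_n)) : seq (bool * 'I_n) :=
  head w (pmap (fun i => cancel_front (rot i w)) (iota 0 (size w))).

(* Every effective step shortens w, so size w steps exhaust all matches. *)
Definition unmatched (n : nat) (w : seq (bool * 'I_n)) : seq (bool * 'I_n) :=
  iter (size w) (@cancel_step n) w.

(* Below A is the lower row and B the upper row. *)
Definition unpaired_low (n : nat) (A B : {mset 'I_n}) : {mset 'I_n} :=
  mset_of_mult (fun j => count_mem (true, j) (unmatched (bracket_word A B))).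

Definition unpaired_up (n : nat) (A B : {mset 'I_n}) : {mset 'I_n} :=
  mset_of_mult (fun j => count_mem (false, j) (unmatched (bracket_word A B))).

Definition paired_low (n : nat) (A B : {mset 'I_n}) : {mset 'I_n} :=
  A `\` unpaired_low A B.

Definition label_class (n : nat) (W : word n) (l : nat) : {mset 'I_n} :=
  mset_of_mult (fun j => W j l).

(* W labels the row above; the state is the multiset of particles of the current
   row that are not yet paired, together with the labels given so far. *)
Definition fm_pass (n : nat) (W : word n) (st : {mset 'I_n} * word n) (l : nat) :
    {mset 'I_n} * word n :=
  let: (R, Y) := st in
  let P := paired_low R (label_class W l) in
  (R `\` P, [ffun j => Y j `+` msetn (P j) l]).

(* Labelling of row r with particles D, given the labelling W of row r + 1: the
   passes for l = k, k - 1, ..., r + 1, after which the unlabelled particles get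
   label r. For r = k there is no pass and W is irrelevant. *)
Definition fm_row (k n r : nat) (D : {mset 'I_n}) (W : word n) : word n :=
  let: (R, Y) := foldl (fm_pass W) (D, empty_word n) (rev (iota r.+1 (k - r))) in
  [ffun j => Y j `+` msetn (R j) r].

(* fm_labels D i is the labelling of row i + 1. *)
Definition fm_labels (k n : nat) (D : bmlq k n) (i : nat) : word n :=
  foldr (fun (h : 'I_k) W => fm_row k h.+1 (tnth D h) W) (empty_word n)
        (drop i (enum 'I_k)).

Definition Phi_FM (k n : nat) (D : bmlq k n) : word n := fm_labels D 0.

Definition letters (n : nat) (u : word n) : seq nat :=
  flatten [seq enum_mset (u j) | j <- enum 'I_n].

Definition max_letter (n : nat) (u : word n) : nat := \max_(x <- letters u) x.

Definition min_letter (n : nat) (u : word n) : nat :=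
  \big[minn/max_letter u]_(x <- letters u) x.

Definition upper_mset (n : nat) (u : word n) (r : nat) : {mset 'I_n} :=
  mset_of_mult (fun j => count (leq r) (u j)).

(* The largest r in {a, ..., K} with |D| <= |u^(r)|, and a if there is none. *)
Definition threshold (n : nat) (D : {mset 'I_n}) (u : word n) : nat :=
  let a := min_letter u in
  let K := max_letter u in
  last a [seq r <- iota a (K.+1 - a) | size D <= size (upper_mset u r)].

(* The operator D^(l). It is meaningful when l is smaller than every letter of u;
   truncated subtraction is harmless since both families of counts are monotone
   in r. As letters are multisets, the order of the additions is immaterial. *)
Definition row_op (n : nat) (D : {mset 'I_n}) (l : nat) (u : word n) : word n :=
  if u == empty_word n then [ffun j => msetn (D j) l] else
  let a := min_letter u in
  let K := max_letter u in
  let s := threshold D u in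
  let newly_paired r j :=
    paired_low D (upper_mset u r) j - paired_low D (upper_mset u r.+1) j in
  let newly_unpaired r j :=
    unpaired_up D (upper_mset u r) j - unpaired_up D (upper_mset u r.+1) j in
  [ffun j =>
     (\big[@msetD nat/mset0]_(s <= r < K.+1) msetn (newly_paired r j) r)
     `+` msetn (unpaired_low D (upper_mset u s) j) l
     `+` (\big[@msetD nat/mset0]_(a <= r < s.+1) msetn (newly_unpaired r j) r.-1)].

(* pairing_labels D i is D_{i+1}^(i+1)(... D_k^(k)(empty_word) ...). *)
Definition pairing_labels (k n : nat) (D : bmlq k n) (i : nat) : word n :=
  foldr (fun (h : 'I_k) u => row_op (tnth D h) h.+1 u) (empty_word n)
        (drop i (enum 'I_k)).

Definition Phi (k n : nat) (D : bmlq k n) : word n := pairing_labels D 0.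

(* Main.v *)
Require Import Defs.
From mathcomp Require Import all_boot.
From mathcomp Require Import finmap multiset zify.

(** Straightness makes the collapsing phase void. The labelling u of the row
    above has as many letters as that row has particles, hence at most as many
    as the current row D. So the threshold s is the smallest letter of u, and
    every particle of u^(s) finds a partner. The operator thus labels D by the
    increments of the paired sets of D against u^(K), u^(K-1), ..., u^(s),
    whereas the Ferrari-Martin passes pair, at each step, only the particles
    that carry the current label, against what the earlier passes left over.
    The two agree because pairing D with a union B + C leaves the same lower
    particles unpaired as pairing with B first and then pairing the remainder
    with C (unpaired_lowD); one induction over the passes (fm_passesE) then
    identifies each row, and one over the rows identifies the labellings.

    The additivity of pairing comes from a description of cyclic matching by a
    flow. Read a bracket word from right to left, carrying the number of upper
    particles still waiting for a partner: a closing bracket adds one, an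
    opening bracket absorbs one, or stays free if none is waiting. On a circle
    the reading must end with the number m that it started with (steady), and
    when there are at least as many opening as closing brackets, such an m
    exists (steady_exists). Rotations and cancellations transport steady
    readings without changing the free brackets, so for any such m these are
    the brackets left by the matching procedure (count_unmatched). Finally a
    steady flow for B plus a steady flow for C on the remainder is a steady flow
    for B + C with the same free brackets, by
    (x + y) - a = (x - a) + (y - (a - x)) for truncated subtraction
    (site_wordD). *)

Set Implicit Arguments.
Unset Strict Implicit.
Unset Printing Implicit Defensive.

Local Open Scope mset_scope.

(** * Cyclic matching as a steady flow *)

Section BracketWords.

Variable n : nat.
Implicit Types (w x y : seq (bool * 'I_n)) (m p : nat) (j : 'I_n).

Definition opens w := count (fun e => e.1) w.
Definition closers w := count (fun e => ~~ e.1) w.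

(** The number of closing brackets still waiting for a partner after w has been
    read from right to left, when m are waiting at the start; an opening bracket
    absorbs one of them, if any. *)
Fixpoint pending w m : nat :=
  if w is (b, _) :: w' then
    if b then (pending w' m).-1 else (pending w' m).+1
  else m.

(** The opening brackets at site j that meet no waiting closing bracket during
    the same reading. *)
Fixpoint free w m j : nat :=
  if w is (b, i) :: w' then
    [&& b, i == j & pending w' m == 0] + free w' m j
  else 0.

Lemma pending_cat x y m : pending (x ++ y) m = pending x (pending y m).
Proof. by elim: x => //= -[b i] x ->. Qed.

Lemma free_cat x y m j :
  free (x ++ y) m j = free x (pending y m) j + free y m j.
Proof. by elim: x => //= -[b i] x ->; rewrite pending_cat addnA. Qed.

Lemma leq_pending w m p : m <= p -> pending w m <= pending w p.
Proof. by move=> lemp; elim: w => //= -[[] i] w; lia. Qed.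

(** Every closing bracket, read or carried in, is either absorbed by an opening
    bracket that is not free or carried out. *)
Lemma pending_balance w m :
  \sum_j free w m j + closers w + m = opens w + pending w m.
Proof.
elim: w => [|[b i] w IHw] /=; first by rewrite big1 // !add0n.
rewrite big_split /= /opens /closers /= -/(opens w) -/(closers w).
have -> : \sum_j [&& b, i == j & pending w m == 0] = b && (pending w m == 0).
  rewrite (bigD1 i) //= eqxx big1 ?addn0 // => j /negPf ne_ji.
  by rewrite eq_sym ne_ji andbF.
by case: b; case: (pending w m) IHw => [|q] /=; lia.
Qed.

(** A free bracket marks a moment when nothing is waiting, and from there on the
    reading has forgotten how it started. *)
Lemma free_pending w m j : 0 < free w m j -> pending w m = pending w 0.
Proof.
elim: w => //= -[b i] w IHw.
rewrite addn_gt0 lt0b => /orP[/and3P[-> _]|/IHw->//].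
by have := leq_pending w (leq0n m); lia.
Qed.

(** On a circle the reading resumes where it ended, so the number carried in
    must equal the number carried out. *)
Definition steady w m := pending w m == m.

(** One turn from 0 suffices. If the second turn still frees a bracket, it ends
    like the first; otherwise the balance leaves it no room to grow. *)
Lemma steady_exists w : closers w <= opens w -> exists m, steady w m.
Proof.
move=> le_co; exists (pending w 0); apply/eqP; set m := pending w 0.
have [/existsP[j /free_pending//]|] := boolP [exists j, 0 < free w m j].
rewrite negb_exists => /forallP no_free; have := pending_balance w m.
rewrite big1 => [|j _]; last by have := no_free j; lia.
by have := leq_pending w (leq0n m); lia.
Qed.

Lemma steady_rot k w m : steady w m ->
  exists2 p, steady (rot k w) p & free (rot k w) p =1 free w m.
Proof.
rewrite /steady -{1}(cat_take_drop k w) pending_cat => /eqP st_m.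
exists (pending (drop k w) m) => [|j]; first by rewrite /rot pending_cat st_m.
by rewrite -[in RHS](cat_take_drop k w) !free_cat st_m addnC.
Qed.

Lemma cancel_frontP w w' : cancel_front w = Some w' ->
  exists i j, w = (true, i) :: (false, j) :: w'.
Proof. by case: w => [|[[] i] [|[[] j] v]] //= [<-]; exists i, j. Qed.

(** The case analysis of a step: some rotation exposes the deleted pair, or the
    word is irreducible, even under rotations beyond its size. *)
Lemma cancel_stepP w :
  (exists k i j, rot k w = (true, i) :: (false, j) :: cancel_step w) \/
  (cancel_step w = w /\ forall k, cancel_front (rot k w) = None).
Proof.
rewrite /cancel_step; set s := pmap _ _.
have memP w' : w' \in s <->
    exists2 k, k < size w & cancel_front (rot k w) = Some w'.
  rewrite mem_pmap; split=> [/mapP[k]|[k lt_kw def_w']].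
    by rewrite mem_iota => /= lt_kw ->; exists k.
  by apply/mapP; exists k; rewrite ?mem_iota.
case def_s: s => [|w' s'] /=; [right | left]; last first.
  have /memP[k _ /cancel_frontP] : w' \in s by rewrite def_s mem_head.
  by exists k.
split=> // k; case def_w': (cancel_front _) => [w'|//].
suff: w' \in s by rewrite def_s.
apply/memP; have [lt_kw|le_wk] := ltnP k (size w); first by exists k.
exists 0; last by rewrite rot0 -def_w' rot_oversize.
by rewrite lt0n size_eq0; apply: contra_eq_neq def_w' => ->.
Qed.

Lemma cancel_step_counts w :
  exists c, opens w = opens (cancel_step w) + c /\
            closers w = closers (cancel_step w) + c.
Proof.
have [[k [i [j def_w]]]|[-> _]] := cancel_stepP w; last by exists 0; lia.
exists 1; have /seq.permP count_w : perm_eq (rot k w) w by rewrite perm_rot.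
by rewrite /opens /closers -!count_w def_w /=; lia.
Qed.

(** An adjacent matched pair raises and then lowers the waiting number by one,
    so deleting it is invisible to the rest of the reading. *)
Lemma steady_cancel_step w m : steady w m ->
  exists2 p, steady (cancel_step w) p & free (cancel_step w) p =1 free w m.
Proof.
have [[k [i [j def_w]]]|[-> _]] := cancel_stepP w; last by exists m.
case/(steady_rot k) => p; rewrite /steady def_w /= => st_p free_p.
by exists p => // q; rewrite -free_p /= !andbF.
Qed.

Lemma adjacent_after_open i w : ~~ all (fun e => e.1) w ->
  exists a i' j b, (true, i) :: w = a ++ (true, i') :: (false, j) :: b.
Proof.
elim: w i => //= -[[] j] w IHw i /=; last by exists [::], i, j, w.
by case/(IHw j) => [a [i' [j' [b ->]]]]; exists ((true, i) :: a), i', j', b.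
Qed.

(** Rotate so that an opening bracket comes first: the first closing bracket
    then directly follows an opening one. *)
Lemma cyclically_adjacent w :
    has (fun e => e.1) w -> ~~ all (fun e => e.1) w ->
  exists k, cancel_front (rot k w) != None.
Proof.
case/hasP=> -[[] i] // /rot_to[k y def_y] _ not_all.
have [|a [i' [j [b def_ab]]]] := @adjacent_after_open i y.
  apply: contra not_all.
  have /perm_all <- : perm_eq (rot k w) w by rewrite perm_rot.
  by rewrite def_y.
exists (rot_add w k (size a)); rewrite -rot_rot_add def_y def_ab.
by rewrite rot_size_cat.
Qed.

(** A step either fixes the word or shortens it, so the size of the word bounds
    the number of effective steps. *)
Lemma unmatched_stable w : cancel_step (unmatched w) = unmatched w.
Proof.
rewrite /unmatched.
suff H t v : size v <= t ->
    cancel_step (iter t (@cancel_step n) v) = iter t (@cancel_step n) v.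
  exact: H.
elim: t v => [|t IHt] v; first by rewrite leqn0 size_eq0 => /eqP->.
move=> le_vt; have [[k [i [j def_v]]]|[fix_v _]] := cancel_stepP v.
  rewrite iterSr; apply: IHt.
  by move: le_vt; rewrite -(size_rot k v) def_v /=; lia.
by rewrite iter_fix.
Qed.

Lemma unmatched_counts w : exists c, opens w = opens (unmatched w) + c /\
                                     closers w = closers (unmatched w) + c.
Proof.
rewrite /unmatched; elim: (size w) => [|t [c [-> ->]]] /=.
  by exists 0; lia.
have [c' [-> ->]] := cancel_step_counts (iter t (@cancel_step n) w).
by exists (c' + c); lia.
Qed.

Lemma steady_unmatched w m : steady w m ->
  exists2 p, steady (unmatched w) p & free (unmatched w) p =1 free w m.
Proof.
move=> st_m; rewrite /unmatched; elim: (size w) => [|t [p st_p free_p]] /=.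
  by exists m.
have [q st_q free_q] := steady_cancel_step st_p; exists q => // j.
by rewrite free_q free_p.
Qed.

(** Cancellation preserves the difference between the numbers of opening and
    closing brackets, and an irreducible word cannot contain both kinds. *)
Lemma all_opens_unmatched w : closers w <= opens w ->
  all (fun e => e.1) (unmatched w).
Proof.
move=> le_co; apply: contraT => not_all.
have has_open : has (fun e => e.1) (unmatched w).
  have [c [def_o def_c]] := unmatched_counts w.
  rewrite has_count -/(opens _); move: not_all.
  have -> : all (fun e : bool * 'I_n => e.1) (unmatched w) =
            (closers (unmatched w) == 0).
    rewrite /closers eqn0Ngt -has_count -all_predC.
    by apply: eq_all => e /=; rewrite negbK.
  by lia.
have [k] := cyclically_adjacent has_open not_all.
have [[k' [i [j]]]|[_ ->//]] := cancel_stepP (unmatched w).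
by move/(congr1 size); rewrite size_rot unmatched_stable /=; lia.
Qed.

(** On a nonempty word without closing brackets the waiting number only drops,
    so a steady reading starts from 0 and every bracket is free. *)
Lemma free_all_opens w m : all (fun e => e.1) w ->
  pending w m = m - size w /\
  (m = 0 -> forall j, free w m j = count_mem (true, j) w).
Proof.
elim: w => [_|[b i] w IHw /= /andP[-> /IHw[def_p free_w]]].
  by split=> //=; lia.
split=> [|m0 j]; first by rewrite def_p; lia.
by rewrite free_w // def_p m0 sub0n eqxx andbT xpair_eqE.
Qed.

(** The outcome of the matching procedure, read off from any steady flow. *)
Lemma count_unmatched w m j : closers w <= opens w -> steady w m ->
  count_mem (true, j) (unmatched w) = free w m j.
Proof.
move=> le_co /steady_unmatched[p st_p <-].
have all_o := all_opens_unmatched le_co.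
move: st_p; rewrite /steady (free_all_opens p all_o).1 => st_p.
have [p0|] := posnP p; first by rewrite (free_all_opens p all_o).2.
case: (unmatched w) st_p => //= e v; lia.
Qed.

Lemma count_unmatched_closers w j : closers w <= opens w ->
  count_mem (false, j) (unmatched w) = 0.
Proof.
move=> /all_opens_unmatched /allP all_o; apply/count_memPn.
by apply/negP=> /all_o.
Qed.

End BracketWords.

(** * Additivity of pairing *)

Section Pairing.

Variable n : nat.
Implicit Types (A B C : {mset 'I_n}) (a b c : 'I_n -> nat) (i j : 'I_n).
Implicit Types (s : seq 'I_n) (m : nat).

Lemma size_mset_of_mult a : size (mset_of_mult a) = \sum_j a j.
Proof.
rewrite (perm_size (perm_eq_seq_mset _)) size_flatten /shape -map_comp.
by rewrite sumn_map big_enum; apply: eq_bigr => j _ /=; rewrite size_nseq.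
Qed.

Lemma size_mset_sum A : size A = \sum_j A j.
Proof.
rewrite -size_mset_of_mult; congr (size (enum_mset _)).
by apply/msetP => j; rewrite mset_of_multE.
Qed.

(** The bracket word restricted to a list of sites, so that facts about it can
    be proved by induction on the sites. *)
Definition site_word s a b : seq (bool * 'I_n) :=
  flatten [seq nseq (b j) (false, j) ++ nseq (a j) (true, j) | j <- s].

Lemma pending_nseq e m p j :
  pending (nseq p (e, j)) m = if e then m - p else m + p.
Proof. by case: e; elim: p => [|p IHp] /=; lia. Qed.

Lemma free_nseq e m p i j :
  free (nseq p (e, i)) m j = if e && (i == j) then p - m else 0.
Proof.
elim: p => [|p IHp] /=; first by rewrite sub0n if_same.
by rewrite IHp pending_nseq; case: (e) (i == j) => [] [] //=; lia.
Qed.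

Lemma pending_site_word i s a b m : pending (site_word (i :: s) a b) m =
  pending (site_word s a b) m - a i + b i.
Proof. by rewrite /site_word /= !pending_cat !pending_nseq. Qed.

Lemma free_site_word i s a b m j : free (site_word (i :: s) a b) m j =
  (if i == j then a i - pending (site_word s a b) m else 0) +
  free (site_word s a b) m j.
Proof. by rewrite /site_word /= !free_cat !free_nseq. Qed.

Lemma free_notin s a b m j : j \notin s -> free (site_word s a b) m j = 0.
Proof.
elim: s => // i s IHs; rewrite inE negb_or eq_sym => /andP[/negPf ne_ij /IHs].
by rewrite free_site_word ne_ij.
Qed.

Lemma free_leq s a b m j : uniq s -> free (site_word s a b) m j <= a j.
Proof.
elim: s => // i s IHs /= /andP[s'i /IHs le_a]; rewrite free_site_word.
by case: eqP => // <-; rewrite (free_notin _ _ _ s'i) addn0 leq_subr.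
Qed.

(** Superposition of flows: if a' is what the closers b leave of the openers a,
    then reading b + c against a is the same as reading b against a and c
    against a', with the waiting numbers added site by site. *)
Lemma site_wordD s a a' b c m p : uniq s ->
    {in s, a' =1 free (site_word s a b) m} ->
  let bc j := b j + c j in
  pending (site_word s a bc) (m + p) =
    pending (site_word s a b) m + pending (site_word s a' c) p /\
  {in s, free (site_word s a bc) (m + p) =1 free (site_word s a' c) p}.
Proof.
move=> + + bc; elim: s => //= i s IHs /andP[s'i s_uniq] def_a'.
have a'i : a' i = a i - pending (site_word s a b) m.
  rewrite def_a' ?mem_head // free_site_word eqxx.
  by rewrite (free_notin _ _ _ s'i) addn0.
have [|IHp IHf] := IHs s_uniq.
  move=> j sj; rewrite def_a' ?in_cons ?sj ?orbT // free_site_word.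
  by case: eqP s'i => // ->; rewrite sj.
split=> [|j]; first by rewrite !pending_site_word IHp a'i /bc; lia.
rewrite inE !free_site_word [i == j]eq_sym; case: eqP => [-> _|_] /=.
  by rewrite !(free_notin _ _ _ s'i) IHp a'i; lia.
exact: IHf.
Qed.

Lemma opens_bracket_word A B : opens (bracket_word A B) = size A.
Proof.
rewrite /opens count_flatten -map_comp sumn_map big_enum size_mset_sum.
apply: eq_bigr => j _ /=; rewrite count_cat !count_nseq /=.
by rewrite ?mul0n ?mul1n ?addn0.
Qed.

Lemma closers_bracket_word A B : closers (bracket_word A B) = size B.
Proof.
rewrite /closers count_flatten -map_comp sumn_map big_enum size_mset_sum.
apply: eq_bigr => j _ /=; rewrite count_cat !count_nseq /=.
by rewrite ?mul0n ?mul1n ?addn0.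
Qed.

Lemma unpaired_lowE A B m j : size B <= size A -> steady (bracket_word A B) m ->
  unpaired_low A B j = free (bracket_word A B) m j.
Proof.
move=> le_BA st_m; rewrite mset_of_multE (count_unmatched _ _ st_m) //.
by rewrite opens_bracket_word closers_bracket_word.
Qed.

Lemma steady_bracket_word A B : size B <= size A ->
  exists m, steady (bracket_word A B) m.
Proof.
move=> leBA; apply: steady_exists.
by rewrite opens_bracket_word closers_bracket_word.
Qed.

Lemma unpaired_low_leq A B j : size B <= size A -> unpaired_low A B j <= A j.
Proof.
move=> leBA; have [m st_m] := steady_bracket_word leBA.
by rewrite (unpaired_lowE _ leBA st_m) free_leq // enum_uniq.
Qed.

Lemma size_unpaired_low A B : size B <= size A ->
  size (unpaired_low A B) = size A - size B.
Proof.
move=> leBA; have [m st_m] := steady_bracket_word leBA.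
rewrite size_mset_sum; under eq_bigr do rewrite (unpaired_lowE _ leBA st_m).
have := pending_balance (bracket_word A B) m.
by rewrite opens_bracket_word closers_bracket_word (eqP st_m); lia.
Qed.

(** With no upper particles, 0 is a steady start and nothing is absorbed. *)
Lemma unpaired_low0 A : unpaired_low A mset0 = A.
Proof.
have size0 : size (mset0 : {mset 'I_n}) = 0 by rewrite enum_mset0.
have word0 s : pending (site_word s A (mset0 : {mset 'I_n})) 0 = 0.
  by elim: s => // i s; rewrite pending_site_word mset0E => ->.
apply/msetP => j; rewrite (@unpaired_lowE _ _ 0) ?size0 //; last first.
  by rewrite /steady -[bracket_word A _]/(site_word _ _ _) word0.
rewrite -[bracket_word A _]/(site_word _ _ _).
have: j \in enum 'I_n by rewrite mem_enum.
elim: (enum 'I_n) (enum_uniq 'I_n) => //= i s IHs.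
move=> /andP[s'i /IHs]; rewrite inE eq_sym free_site_word word0 subn0.
by case: eqP => [<- _ _|_ IHj /IHj->]; rewrite ?(free_notin _ _ _ s'i) ?addn0.
Qed.

(** Pairing with B and C together or successively leaves the same lower
    particles: the sum of a steady flow for each stage is steady for the
    union. *)
Lemma unpaired_lowD A B C : size B + size C <= size A ->
  unpaired_low A (B `+` C) = unpaired_low (unpaired_low A B) C.
Proof.
move=> le_BCA; have leBA : size B <= size A by lia.
have leCU : size C <= size (unpaired_low A B) by rewrite size_unpaired_low; lia.
have sizeBC : size (B `+` C) = size B + size C.
  by rewrite !size_mset_sum -big_split; apply: eq_bigr => j _; rewrite msetE2.
have [m st_m] := steady_bracket_word leBA.
have [p st_p] := steady_bracket_word leCU.
have [||pendD freeD] := @site_wordD (enum 'I_n) A (unpaired_low A B) B C m p.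
- exact: enum_uniq.
- by move=> j _; apply: unpaired_lowE.
have bcE : bracket_word A (B `+` C) =
           site_word (enum 'I_n) A (fun j => B j + C j).
  by congr flatten; apply: eq_map => j; rewrite msetE2.
apply/msetP => j; rewrite (unpaired_lowE _ leCU st_p).
rewrite (@unpaired_lowE _ _ (m + p)) ?sizeBC // bcE.
  by apply: freeD; rewrite mem_enum.
by rewrite /steady pendD; apply/eqP; congr (_ + _); apply/eqP.
Qed.

Lemma unpaired_up_eq0 A B j : size B <= size A -> unpaired_up A B j = 0.
Proof.
move=> leBA; rewrite mset_of_multE count_unmatched_closers //.
by rewrite opens_bracket_word closers_bracket_word.
Qed.

End Pairing.

(** * Labels of one row *)

Lemma size_msetD (T : choiceType) (A B : {mset T}) :
  size (A `+` B) = size A + size B.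
Proof.
rewrite -size_cat; apply/perm_size/eq_seq_msetP/msetP => x.
by rewrite !mset_seqE count_cat !count_mem_mset msetE2.
Qed.

Section Labels.

Variable n : nat.
Implicit Types (W u : word n) (D : {mset 'I_n}) (j : 'I_n) (t r k : nat).

Lemma lettersP W t : reflect (exists j, 0 < W j t) (t \in letters W).
Proof.
apply: (iffP flatten_mapP) => [[j _]|[j]]; last first.
  by rewrite mset_gt0 => tj; exists j; rewrite ?mem_enum.
by exists j; rewrite mset_gt0.
Qed.

Lemma size_letters W : size (letters W) = \sum_j size (W j).
Proof. by rewrite size_flatten /shape -map_comp sumn_map big_enum. Qed.

Lemma letters_empty : letters (empty_word n) = [::].
Proof.
apply/nilP; rewrite /nilp size_letters big1 // => j _.
by rewrite ffunE enum_mset0.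
Qed.

Lemma letters_neq0 W : W != empty_word n -> letters W != [::].
Proof.
apply: contraNneq => W0; apply/eqP/ffunP => j; apply/msetP => t.
rewrite ffunE mset0E; apply/eqP; rewrite -leqn0 leqNgt; apply/negP => Wjt.
by have : t \in letters W by [apply/lettersP; exists j]; rewrite W0.
Qed.

Lemma leq_max_letter W t : t \in letters W -> t <= max_letter W.
Proof. by move=> Wt; apply: (@leq_bigmax_seq _ _ xpredT id). Qed.

Lemma min_letter_leq W t : t \in letters W -> min_letter W <= t.
Proof.
rewrite /min_letter; elim: (letters W) (max_letter W) => // x s IHs b.
by rewrite inE big_cons geq_min => /predU1P[->|/IHs->]; rewrite ?leqnn ?orbT.
Qed.

Lemma max_letter_mem W : letters W != [::] -> max_letter W \in letters W.
Proof.
rewrite /max_letter; elim: (letters W) => // x [|y s] IHs _.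
  by rewrite big_cons big_nil maxn0 mem_head.
rewrite big_cons inE /maxn; case: ifP => _; last by rewrite eqxx.
by rewrite IHs // orbT.
Qed.

Lemma min_letter_mem W : letters W != [::] -> min_letter W \in letters W.
Proof.
move=> /max_letter_mem; rewrite /min_letter.
suff H s b : \big[minn/b]_(x <- s) x \in b :: s.
  by move: (H (letters W) (max_letter W)); rewrite inE => /predU1P[->|].
elim: s => [|x s IHs]; first by rewrite big_nil mem_head.
rewrite big_cons /minn; case: ifP => _; first by rewrite !inE eqxx orbT.
by move: IHs; rewrite !inE orbCA => ->; rewrite orbT.
Qed.

Lemma upper_msetS W t :
  upper_mset W t = upper_mset W t.+1 `+` label_class W t.
Proof.
apply/msetP => j; rewrite msetE2 !mset_of_multE -count_mem_mset addnC.
rewrite -count_predUI [X in _ + X](eq_count (a2 := pred0)) ?count_pred0 ?addn0.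
  by apply: eq_count => x /=; rewrite leq_eqVlt eq_sym.
by move=> x /=; case: eqP => // ->; rewrite ltnn.
Qed.

(** Raising the bound past a value that is not a letter changes nothing; this
    lets label ranges be extended freely beyond the extreme letters. *)
Lemma upper_mset_notin W t :
  t \notin letters W -> upper_mset W t = upper_mset W t.+1.
Proof.
move=> W't; rewrite upper_msetS; apply/msetP => j.
rewrite msetE2 !mset_of_multE.
suff -> : W j t = 0 by rewrite addn0.
apply/eqP; rewrite -leqn0 leqNgt; apply: contra W't => Wjt.
by apply/lettersP; exists j.
Qed.

Lemma upper_mset_eq W t r : {in letters W, forall x, (t <= x) = (r <= x)} ->
  upper_mset W t = upper_mset W r.
Proof.
move=> eq_tr; apply/msetP => j; rewrite !mset_of_multE.
apply: eq_in_count => x Wx.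
by apply: eq_tr; apply/lettersP; exists j; rewrite mset_gt0.
Qed.

Lemma upper_mset_gt W t :
  {in letters W, forall x, x < t} -> upper_mset W t = mset0.
Proof.
move=> W_lt; apply/msetP => j; rewrite mset0E mset_of_multE; apply/eqP.
rewrite -leqn0 leqNgt -has_count -all_predC; apply/allP => x Wx /=.
by rewrite -ltnNge W_lt //; apply/lettersP; exists j; rewrite mset_gt0.
Qed.

Lemma size_upper_mset W t : size (upper_mset W t) <= size (letters W).
Proof.
rewrite size_mset_of_mult size_letters leq_sum // => j _.
exact: count_size.
Qed.

Definition newly_paired D W t j :=
  paired_low D (upper_mset W t) j - paired_low D (upper_mset W t.+1) j.

Lemma newly_paired_notin D W t j :
  t \notin letters W -> newly_paired D W t j = 0.
Proof. by move=> W't; rewrite /newly_paired upper_mset_notin // subnn. Qed.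

(** One Ferrari-Martin pass against one increment of the pairing phase: the
    unpaired particles for u^(t) are those left when the particles labelled t
    are paired with what u^(t+1) left unpaired. *)
Lemma unpaired_low_upper D W t : size (letters W) <= size D ->
  unpaired_low D (upper_mset W t) =
  unpaired_low (unpaired_low D (upper_mset W t.+1)) (label_class W t).
Proof.
move=> leWD; rewrite upper_msetS unpaired_lowD // -size_msetD -upper_msetS.
exact: leq_trans (size_upper_mset W t) leWD.
Qed.

Lemma unpaired_low_upper_leq D W t j : size (letters W) <= size D ->
  unpaired_low D (upper_mset W t) j <= unpaired_low D (upper_mset W t.+1) j
    <= D j.
Proof.
move=> leWD; have leUD r := leq_trans (size_upper_mset W r) leWD.
rewrite unpaired_low_leq // andbT unpaired_low_upper // unpaired_low_leq //.
rewrite size_unpaired_low //.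
by move: (leUD t); rewrite upper_msetS size_msetD; lia.
Qed.

(** The invariant of the passes for the labels a + c - 1, ..., a. Since no
    letter reaches a + c, the pairing increments at those values vanish and the
    formula for Y needs no upper bound on t. The last clause is
    there to bound the number of letters of the finished row. *)
Lemma fm_passesE D W a c : {in letters W, forall t, t < a + c} ->
    size (letters W) <= size D ->
  let: (R, Y) := foldl (fm_pass W) (D, empty_word n) (rev (iota a c)) in
  [/\ R = unpaired_low D (upper_mset W a),
      forall j t, Y j t = if a <= t then newly_paired D W t j else 0
    & forall j, size (Y j) + R j = D j].
Proof.
move=> + leWD; elim: c a => [|c IHc] a lt_ac /=.
  rewrite addn0 in lt_ac; rewrite upper_mset_gt // unpaired_low0; split=> // j.
    move=> t; rewrite ffunE mset0E; case: leqP => // le_at.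
    by rewrite newly_paired_notin //; apply/negP => /lt_ac; lia.
  by rewrite ffunE enum_mset0.
rewrite rev_cons foldl_rcons.
have /IHc : {in letters W, forall t, t < a.+1 + c} by move=> t /lt_ac; lia.
case: (foldl _ _ _) => R Y /= [def_R def_Y size_Y].
have def_R' : R `\` paired_low R (label_class W a) =
              unpaired_low D (upper_mset W a).
  apply/msetP => j; have /andP[] := unpaired_low_upper_leq a j leWD.
  by rewrite unpaired_low_upper // /paired_low !msetE2 -def_R; lia.
have pairedE j : paired_low R (label_class W a) j = newly_paired D W a j.
  have /andP[] := unpaired_low_upper_leq a j leWD.
  rewrite /newly_paired /paired_low !msetE2 unpaired_low_upper // -def_R; lia.
rewrite def_R'; split=> // j.
  move=> t; rewrite ffunE msetE2 msetnE def_Y pairedE.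
  by case: (ltngtP a t) => [||<-]; rewrite ?addn0.
rewrite ffunE size_msetD enum_msetn size_nseq -size_Y -def_R'.
rewrite /paired_low !msetE2.
by rewrite -addnA subnKC ?leq_subr.
Qed.

(** The second clause propagates through the rows: a row ends with exactly one
    label per particle, which with straightness bounds the number of letters
    that the next row has to pair. *)
Lemma fm_rowE k r D W : r <= k -> {in letters W, forall t, t <= k} ->
    size (letters W) <= size D ->
  (forall j t, fm_row k r D W j t =
    if t == r then unpaired_low D (upper_mset W r.+1) j
    else if r < t then newly_paired D W t j else 0) /\
  size (letters (fm_row k r D W)) = size D.
Proof.
move=> le_rk le_Wk leWD; rewrite /fm_row.
have lt_W : {in letters W, forall t, t < r.+1 + (k - r)}.
  by move=> t /le_Wk; lia.
have := fm_passesE lt_W leWD.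
case: (foldl _ _ _) => R Y [def_R def_Y size_Y]; split=> [j t|].
  rewrite ffunE msetE2 msetnE def_Y def_R; case: eqP => [->|_].
    by rewrite ltnn.
  by rewrite addn0.
rewrite size_letters size_mset_sum; apply: eq_bigr => j _.
by rewrite ffunE size_msetD enum_msetn size_nseq.
Qed.

Lemma fm_row_letters k r D W : r <= k -> {in letters W, forall t, t <= k} ->
    size (letters W) <= size D ->
  {in letters (fm_row k r D W), forall t, r <= t <= k}.
Proof.
move=> le_rk le_Wk leWD t /lettersP[j]; rewrite (fm_rowE le_rk le_Wk leWD).1.
case: (ltngtP t r) => //= [_|->]; last by [].
apply: contraLR; rewrite -leqNgt leqn0 -ltnNge => lt_kt.
by rewrite newly_paired_notin //; apply/negP => /le_Wk; lia.
Qed.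

(** The full set of letters has at most as many elements as D, and raising the
    bound above the smallest letter loses at least one; hence no larger bound
    qualifies, whether or not the smallest letter itself does. *)
Lemma thresholdE D W : W != empty_word n -> size (letters W) <= size D ->
  threshold D W = min_letter W.
Proof.
move=> /letters_neq0/min_letter_mem; set a := min_letter W => Wa leWD.
rewrite /threshold -/a; set s := filter _ _.
suff: all (pred1 a) s by elim: s => //= x s IHs /andP[/eqP->].
apply/allP => t; rewrite mem_filter mem_iota => /and3P[leDt le_at _] /=.
rewrite eqn_leq le_at andbT leqNgt; apply/negP => lt_at.
have [j Wja] := lettersP _ _ Wa.
suff: size (upper_mset W t) < size (letters W) by lia.
rewrite size_mset_of_mult size_letters (bigD1 j) // [X in _ < X](bigD1 j) //=.
rewrite -addSn leq_add //; last by rewrite leq_sum // => i _; apply: count_size.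
rewrite -(count_predC (leq t) (W j)) -addn1 leq_add2l -has_count.
by apply/hasP; exists a; rewrite /= -?ltnNge -?mset_gt0.
Qed.

Lemma big_msetn_nat a b (f : nat -> nat) t :
  (\big[@msetD nat/mset0]_(a <= r < b) msetn (f r) r) t =
  if a <= t < b then f t else 0.
Proof.
have evalD := big_morph (fun A : {mset nat} => A t) (id1 := 0) (op1 := addn).
rewrite evalD; last first.
- by rewrite mset0E.
- by move=> A B; rewrite msetE2.
under eq_bigr do rewrite msetnE eq_sym.
by rewrite -big_mkcond big_nat1_eq.
Qed.

(** The operator and the Ferrari-Martin row obey the same formula. The
    collapsing phase reduces to its single term at the smallest letter, which is
    zero as all upper particles are paired. *)
Lemma row_opE r D W : {in letters W, forall t, r < t} ->
    size (letters W) <= size D ->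
  forall j t, row_op D r W j t =
    if t == r then unpaired_low D (upper_mset W r.+1) j
    else if r < t then newly_paired D W t j else 0.
Proof.
move=> lt_rW leWD j t; rewrite /row_op; case: eqP => [->|/eqP W_neq0].
  have upper0 x : upper_mset (empty_word n) x = mset0.
    by apply: upper_mset_gt; rewrite letters_empty.
  by rewrite ffunE msetnE /newly_paired !upper0 unpaired_low0 subnn if_same.
have lt_ra := lt_rW _ (min_letter_mem (letters_neq0 W_neq0)).
rewrite thresholdE // ffunE !msetE2 big_msetn_nat.
rewrite big_ltn // big_geq // msetD0 msetnE.
rewrite unpaired_up_eq0 ?(leq_trans (size_upper_mset _ _)) //.
rewrite sub0n msetn0 mset0E addn0.
rewrite (@upper_mset_eq _ (min_letter W) r.+1) => [|x Wx]; last first.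
  by rewrite lt_rW // min_letter_leq.
case: ifP => [/andP[le_at _]|out_t].
  by case: ltngtP (leq_trans lt_ra le_at) => //; rewrite addn0.
case: eqP => // _; case: ifP => // lt_rt; rewrite newly_paired_notin //.
by apply/negP => Wt; move: out_t; rewrite min_letter_leq // ltnS leq_max_letter.
Qed.

Lemma row_op_fm_row k r D W : r <= k -> {in letters W, forall t, r < t <= k} ->
  size (letters W) <= size D -> row_op D r W = fm_row k r D W.
Proof.
move=> le_rk W_rk leWD; apply/ffunP => j; apply/msetP => t.
rewrite row_opE ?(fm_rowE le_rk _ _).1 // => x /W_rk /andP[] //.
Qed.

End Labels.

(** * All rows *)

Section Rows.

Variables (k n : nat) (D : bmlq k n).

Let above : rel 'I_k :=
  [rel h h' : 'I_k | (h < h') && (size (tnth D h') <= size (tnth D h))].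

(** The bounds on the letters and on their number, relative to the row h just
    below the list s, are the hypotheses under which the next row agrees. *)
Lemma rows_agree h s : path above h s ->
  let W := foldr (fun (h : 'I_k) W => fm_row k h.+1 (tnth D h) W)
                 (empty_word n) s in
  [/\ foldr (fun (h : 'I_k) u => row_op (tnth D h) h.+1 u)
            (empty_word n) s = W,
      {in letters W, forall t, h.+1 < t <= k}
    & size (letters W) <= size (tnth D h)].
Proof.
elim: s h => [|h' s IHs] h /=; first by rewrite letters_empty.
case/andP=> /andP[lt_hh' leD] /IHs[-> W_range leWD].
set W := foldr _ _ s in W_range leWD *.
have le_W : {in letters W, forall t, t <= k} by move=> t /W_range/andP[].
split.
- exact: row_op_fm_row.
- by move=> t /(fm_row_letters (ltn_ord h') le_W leWD); lia.
by rewrite (fm_rowE (ltn_ord h') le_W leWD).2.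
Qed.

Lemma sorted_rows : straight D -> sorted above (enum 'I_k).
Proof.
move=> D_straight; rewrite sorted_relI; apply/andP; split.
  by have := iota_ltn_sorted 0 k; rewrite -val_enum_ord sorted_map.
move: D_straight; rewrite /straight /bmlq_type -[X in map _ X](map_tnth_enum D).
by rewrite -map_comp sorted_map.
Qed.

Lemma pairing_labels_fm i : straight D -> pairing_labels D i = fm_labels D i.
Proof.
move=> /sorted_rows/(drop_sorted i).
rewrite /pairing_labels /fm_labels; case: (drop _ _) => //= h s.
case/rows_agree=> [-> W_range leWD].
exact: row_op_fm_row.
Qed.

End Rows.

Theorem lemma3p9 (k n : nat) (hn : 0 < n) (D : bmlq k n) (hD : straight D) :
  (forall i : 'I_k, pairing_labels D i = fm_labels D i) /\ Phi D = Phi_FM D.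
Proof. by split=> [i|]; apply: pairing_labels_fm. Qed.
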